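(* Let $X$ be an $n$-dimensional complex manifold, $Y\subset X$ a complex submanifold, $\mathcal M$ a coherent left $\mathcal D_X$-module, $p\in Y$, and $u$ a section of $\mathcal M$ defined on a neighborhood of $p$. Let $x''$ be a local coordinate system of $Y$ around $p$. Assume that the $b$-function $b(s)$ of $u$ along $Y$ at $p$ exists. Then: 1. An indicial polynomial $\tilde b(s,x'')$ of $u$ along $Y$ at $p$ exists, and $\tilde b(s,p)$ divides $b(s)$ in $\mathbb C[s]$. 2. The set of the zeros of $\tilde b(s,p)$ coincides with that of $b(s)$.
   Context: $\mathcal O_X$ is the sheaf of holomorphic functions on $X$, $\mathcal D_X$ the sheaf of rings of differential operators with holomorphic coefficients, $\mathcal I_Y\subset\mathcal O_X$ the defining ideal of $Y$. The $V$-filtration along $Y$ is $$V_Y^j(\mathcal D_X)=\{P\in\mathcal D_X|_Y\mid P\,\mathcal I_Y^i\subset\mathcal I_Y^{i-j}\ (\forall i\in\mathbb Z)\}\quad(j\in\mathbb Z),$$ with $\mathcal I_Y^i=\mathcal O_X|_Y$ for $i\le 0$. Let $\theta$ be a vector field near $p$ inducing the identity on $\mathcal I_Y/\mathcal I_Y^2$; in local coordinates $(x_1,\dots,x_n)$ with $Y=\{x_1=\dots=x_d=0\}$ one may take $\theta=x_1\partial_{x_1}+\dots+x_d\partial_{x_d}$, and then $x''=(x_{d+1},\dots,x_n)$ are coordinates of $Y$. The ideal $\mathcal J_Y(u)$ of $\mathcal O_Y[s]$ is $$\mathcal J_Y(u)=\{f(s,x'')\in\mathcal O_Y[s]\mid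 f(\theta,x'')u\in V_Y^{-1}(\mathcal D_X)u\}.$$ The $b$-function of $u$ along $Y$ at $p$ is the monic polynomial $b(s)\in\mathbb C[s]$ of least degree (if any) with $b(\theta)u\in V_Y^{-1}(\mathcal D_X)_pu$, i.e. the monic generator of $\mathcal J_Y(u)_p\cap\mathbb C[s]$ if this ideal is nonzero. An indicial polynomial of $u$ along $Y$ at $p$ is an element $\tilde b(s,x'')\in\mathcal J_Y(u)_p\subset(\mathcal O_Y)_p[s]$ which is monic in $s$ and has the smallest degree in $s$ among the elements of $\mathcal J_Y(u)_p$ that are monic in $s$. $\tilde b(s,p)\in\mathbb C[s]$ is obtained by evaluating the coefficients at $p$.
   Formalization: When Y is open near p (codimension d = 0), θ is required to be 0, as in the formula θ = x_1∂_1+…+x_d∂_d; for arbitrary θ there the claim fails (X = Y = C, θ = ∂_x, u = x, p = 1: b = s², but the indicial polynomial at p is s − 1). *)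

(* Defs.v *)
(* Libraries: MathComp and MathComp-Analysis. *)
From HB Require Import structures.
From mathcomp Require Import all_boot all_order all_algebra.
From mathcomp Require Import all_classical all_reals all_analysis.
From mathcomp Require Import complex generic_quotient ring_quotient.

Set Implicit Arguments.
Unset Strict Implicit.
Unset Printing Implicit Defensive.
Import Order.TTheory GRing.Theory Num.Theory.
Import numFieldNormedType.Exports.

Local Open Scope classical_set_scope.
Local Open Scope ring_scope.

Definition C (R : realType) : numClosedFieldType := R[i]%C.

(** * Complex manifolds and submanifolds *)

(* [coord] and [param] are total functions, meaningful only on [dom] and on
   its image respectively. *)
Record chart (R : realType) (X : topologicalType) (n : nat) := Chart {
  dom : set X;
  coord : X -> 'rV[C R]_n;
  param : 'rV[C R]_n -> X;
  dom_open : open dom;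
  coord_open : open (coord @` dom);
  coordK : forall x, dom x -> param (coord x) = x;
  coord_cont : forall x, dom x -> {for x, continuous coord};
  param_cont : forall x, dom x -> {for coord x, continuous param} }.

(* The transition map from [c] to [c'] is complex differentiable at every
   point of the open set coord c (dom c `&` dom c'). *)
Definition holo_trans R (X : topologicalType) n (c c' : chart R X n) :=
  forall x, dom c x -> dom c' x ->
    differentiable (coord c' \o param c) (coord c x).

(* No countability axiom is imposed. *)
Record cmanifold (R : realType) (n : nat) := CManifold {
  carrier :> topologicalType;
  carrier_hausdorff : hausdorff_space carrier;
  atlas : set (chart R carrier n);
  atlas_cover : forall x, exists2 c, atlas c & dom c x;
  atlas_compat : forall c c', atlas c -> atlas c' -> holo_trans c c' }.

(* Membership in the maximal atlas. *)
Definition holo_chart R n (X : cmanifold R n) (c : chart R X n) :=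
  forall c', atlas c' -> holo_trans c c' /\ holo_trans c' c.

(* Coordinates x = (x', x'') with x' = (x_i)_(i < d), x'' = (x_i)_(d <= i),
   such that Y = {x' = 0}; x'' restricts to local coordinates of Y. *)
Definition adapted_chart R n (X : cmanifold R n) (Y : set X) (d : nat)
    (c : chart R X n) :=
  [/\ (d <= n)%N, holo_chart c &
      forall x, dom c x ->
        (Y x <-> forall i : 'I_n, (i < d)%N -> coord c x ord0 i = 0)].

Definition submanifold R n (X : cmanifold R n) (Y : set X) :=
  forall q, Y q -> exists d c, adapted_chart Y d c /\ dom c q.

Record opens (X : topologicalType) := Opens {
  oset :> set X;
  oset_open : open oset }.

(** * Germs of holomorphic functions *)

(* [f] is holomorphic on a neighbourhood of [q]. *)
Definition holo R n (X : cmanifold R n) (q : X) (f : X -> C R) :=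
  forall c, atlas c -> dom c q ->
    \forall z \near coord c q, differentiable (f \o param c) z.

Section HolFun.
Context {R : realType} {n : nat} {X : cmanifold R n}.
Implicit Types (q : X) (f g : X -> C R).

Definition holo_pred q : {pred X -> C R} := fun f => `[< holo q f >].

Lemma holo_cst q (a : C R) : holo q (cst a).
Proof. by move=> c _ _; apply: filterE => z; exact: differentiable_cst. Qed.

Lemma holoB q f g : holo q f -> holo q g -> holo q (f - g).
Proof.
move=> hf hg c ac cq; have := hg c ac cq; have := hf c ac cq.
by apply: filterS2 => z fz gz; exact: (differentiableB fz gz).
Qed.

Lemma holoM q f g : holo q f -> holo q g -> holo q (f * g).
Proof.
move=> hf hg c ac cq; have := hg c ac cq; have := hf c ac cq.
by apply: filterS2 => z fz gz; exact: (differentiableM fz gz).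
Qed.

Fact holo_subring q : subring_closed (holo_pred q).
Proof.
split; first by apply/asboolP; exact: (@holo_cst q 1).
- by move=> f g /asboolP hf /asboolP hg; apply/asboolP; exact: holoB.
- by move=> f g /asboolP hf /asboolP hg; apply/asboolP; exact: holoM.
Qed.

HB.instance Definition _ q :=
  GRing.isSubringClosed.Build (X -> C R) (holo_pred q) (holo_subring q).

Record holfun q := HolFun { holval :> X -> C R; _ : holval \in holo_pred q }.

HB.instance Definition _ q := [isSub for @holval q].
HB.instance Definition _ q := [Choice of holfun q by <:].
HB.instance Definition _ q :=
  GRing.SubChoice_isSubComPzRing.Build (X -> C R) (holo_pred q) (holfun q)
    (holo_subring q).

Fact holfun_oner_neq0 q : (1 : holfun q) != 0.
Proof.
apply/negP => /eqP /(congr1 (fun h => holval h q)) /eqP.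
by rewrite /= (negbTE (oner_neq0 _)).
Qed.

HB.instance Definition _ q :=
  GRing.PzSemiRing_isNonZero.Build (holfun q) (holfun_oner_neq0 q).

Definition vanish q (A : set X) (_ : A q) : {pred holfun q} :=
  fun h => `[< \forall x \near q, A x -> holval h x = 0 >].

Fact vanish_ideal q (A : set X) (Aq : A q) : idealr_closed (vanish Aq).
Proof.
split.
- by apply/asboolP; apply: nearW.
- apply/negP => /asboolP /nbhs_singleton /(_ Aq) /eqP.
  by rewrite /= (negbTE (oner_neq0 _)).
- move=> a f g /asboolP hf /asboolP hg; apply/asboolP.
  near=> x => Ax.
  have -> : holval (a * f + g) x = holval a x * holval f x + holval g x by [].
  by rewrite (near hf x) ?(near hg x) // mulr0 addr0.
Unshelve. all: by end_near. Qed.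

HB.instance Definition _ q (A : set X) (Aq : A q) :=
  isIdealr.Build (holfun q) (vanish Aq) (vanish_ideal Aq).

End HolFun.

(* Germs at q of functions on A that extend to holomorphic functions of X:
   O_(X,q) when A is the whole manifold, and O_(Y,q) = O_(X,q) / I_(Y,q) when
   A is a submanifold Y through q. *)
Definition germ R n (X : cmanifold R n) (q : X) (A : set X) (Aq : A q) : Type :=
  {ideal_quot vanish Aq}.

HB.instance Definition _ R n (X : cmanifold R n) (q : X) (A : set X)
  (Aq : A q) := GRing.ComNzRing.on (germ Aq).

Section Germs.
Context {R : realType} {n : nat} {X : cmanifold R n}.
Implicit Types (q : X).

(* Junk value 0 when [F] is not holomorphic at [q]. *)
Definition germ_of q (A : set X) (Aq : A q) (F : X -> C R) : germ Aq :=
  (\pi_{ideal_quot vanish Aq} (insubd (0 : holfun q) F))%qT.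

Definition germ_cst q (A : set X) (Aq : A q) (a : C R) : germ Aq :=
  germ_of Aq (cst a).

Definition germ_rep q (A : set X) (Aq : A q) (g : germ Aq) : holfun q :=
  repr (g : {ideal_quot vanish Aq}).

Definition germ_eval q (A : set X) (Aq : A q) (g : germ Aq) : C R :=
  holval (germ_rep g) q.

End Germs.

Definition OX R n (X : cmanifold R n) (q : X) := @germ R n X q setT I.

HB.instance Definition _ R n (X : cmanifold R n) (q : X) :=
  GRing.ComNzRing.on (OX q).

Section Sheaves.
Context {R : realType} {n : nat} {X : cmanifold R n}.
Implicit Types (q x : X) (U V W : opens X) (Y : set X).

Definition gX q (F : X -> C R) : OX q := germ_of (A := setT) (q := q) I F.

Record holsec U := HolSec {
  hsval :> X -> C R;
  hsvalP : forall q, oset U q -> holo q hsval }.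

(** * Differential operators *)

(* Families of maps between the stalks of O_X over the points of [U].  A
   morphism of sheaves O_U -> O_U is determined by such a family. *)
Definition stalk_maps U := forall q, oset U q -> OX q -> OX q.

Definition restr U V (VU : oset V `<=` oset U) (P : stalk_maps U) :
  stalk_maps V := fun q Vq => P q (VU q Vq).

(* The family is induced by a morphism of sheaves. *)
Definition sheaf_map U (P : stalk_maps U) :=
  forall q F, oset U q -> holo q F -> exists2 G, holo q G &
    \forall x \near q, forall Ux : oset U x, P x Ux (gX x F) = gX x G.

(* Sections of Der_C(O_X), i.e. holomorphic vector fields. *)
Definition vector_field U (P : stalk_maps U) :=
  [/\ forall q Uq (a : C R) f g,
        P q Uq (germ_cst _ a * f + g) = germ_cst _ a * P q Uq f + P q Uq g,
      forall q Uq f g, P q Uq (f * g) = P q Uq f * g + f * P q Uq g &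
      sheaf_map P].

(* The ring of operators generated by functions and vector fields on [U]. *)
Inductive do_generated U : stalk_maps U -> Prop :=
| DoFun (F : holsec U) : do_generated (fun q _ f => gX q F * f)
| DoVec P : vector_field P -> do_generated P
| DoAdd P Q : do_generated P -> do_generated Q ->
    do_generated (fun q Uq f => P q Uq f + Q q Uq f)
| DoMul P Q : do_generated P -> do_generated Q ->
    do_generated (fun q Uq f => P q Uq (Q q Uq f)).

(* D_X is the subsheaf of rings of End_C(O_X) generated by O_X and Der_C(O_X). *)
Definition is_diffop U (P : stalk_maps U) :=
  forall q, oset U q -> exists W (WU : oset W `<=` oset U),
    oset W q /\ do_generated (restr WU P).

Lemma vector_field_restr U V (VU : oset V `<=` oset U) (P : stalk_maps U) :
  vector_field P -> vector_field (restr VU P).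
Proof.
move=> [h1 h2 h3]; split => [q Vq|q Vq|q F Vq hF]; [exact: h1|exact: h2|].
have [G hG PG] := h3 q F (VU _ Vq) hF; exists G => //.
by apply: filterS PG => x Px Vx; exact: Px.
Qed.

Lemma do_generated_restr U V (VU : oset V `<=` oset U) (P : stalk_maps U) :
  do_generated P -> do_generated (restr VU P).
Proof.
elim=> [F|{}P hP|{}P Q _ hP _ hQ|{}P Q _ hP _ hQ].
- exact: (DoFun (HolSec (fun q Vq => hsvalP F (VU q Vq)))).
- by apply: DoVec; exact: vector_field_restr.
- exact: DoAdd hP hQ.
- exact: DoMul hP hQ.
Qed.

Lemma do_generated_additive U (P : stalk_maps U) : do_generated P ->
  forall q Uq f g, P q Uq (f + g) = P q Uq f + P q Uq g.
Proof.
elim=> [F|{}P [hP _ _]|{}P Q _ hP _ hQ|{}P Q _ hP _ hQ] q Uq f g.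
- by rewrite mulrDr.
- have := hP q Uq 1 f g.
  have -> : germ_cst _ 1 = 1 :> OX q.
    rewrite /germ_cst /germ_of; have -> : insubd 0 (cst 1) = 1 :> holfun q.
      by apply: val_inj; rewrite val_insubd; case: ifPn => // /asboolP[];
         exact: holo_cst.
    by rewrite (rmorph1 (\pi_({ideal_quot vanish (q:=q) (A:=setT) I})%qT)).
  by rewrite !mul1r.
- by rewrite hP hQ addrACA.
- by rewrite hQ hP.
Qed.

Lemma is_diffop_additive U (P : stalk_maps U) : is_diffop P ->
  forall q Uq f g, P q Uq (f + g) = P q Uq f + P q Uq g.
Proof.
move=> hP q Uq f g; have [W [WU [Wq gP]]] := hP q Uq.
have := do_generated_additive gP Wq f g.
by rewrite /restr (Prop_irrelevance (WU q Wq) Uq).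
Qed.

Fact opensI_subproof U V : open (oset U `&` oset V).
Proof. by apply: openI; exact: oset_open. Qed.

Definition opensI U V := Opens (opensI_subproof U V).

Lemma is_diffop_fun U (F : holsec U) : is_diffop (fun q (_ : oset U q) f => gX q F * f).
Proof.
by move=> q Uq; exists U, (fun x Ux => Ux); split=> //; exact: DoFun.
Qed.

Lemma is_diffop2 U (op : forall W, stalk_maps W -> stalk_maps W -> stalk_maps W)
    (P Q : stalk_maps U) :
  (forall W P' Q', do_generated P' -> do_generated Q' ->
     do_generated (op W P' Q')) ->
  (forall V (VU : oset V `<=` oset U),
     restr VU (op U P Q) = op V (restr VU P) (restr VU Q)) ->
  is_diffop P -> is_diffop Q -> is_diffop (op U P Q).
Proof.
move=> gop rop hP hQ q Uq.
have [W1 [WU1 [W1q gP]]] := hP q Uq; have [W2 [WU2 [W2q gQ]]] := hQ q Uq.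
have s1 : oset (opensI W1 W2) `<=` oset W1 by move=> x [].
have s2 : oset (opensI W1 W2) `<=` oset W2 by move=> x [].
have s : oset (opensI W1 W2) `<=` oset U by move=> x [] /WU1.
exists (opensI W1 W2), s; split=> //.
have eP (T : stalk_maps U) W WU s' :
    restr s T = restr (V:=opensI W1 W2) s' (restr (V:=W) WU T).
  by apply: functional_extensionality_dep => x;
     apply: functional_extensionality_dep => Wx;
     rewrite /restr; congr (T _ _ ); exact: Prop_irrelevance.
rewrite rop; apply: gop.
- by rewrite (eP _ _ WU1 s1); exact: do_generated_restr.
- by rewrite (eP _ _ WU2 s2); exact: do_generated_restr.
Qed.

Record Dop U := DOp { dop : stalk_maps U; dopP : is_diffop dop }.

Lemma Dop_eq U (P Q : Dop U) :
  (forall q Uq f, dop P (q := q) Uq f = dop Q Uq f) -> P = Q.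
Proof.
case: P Q => [P hP] [Q hQ] /= e.
have E : P = Q.
  by apply: functional_extensionality_dep => q;
     apply: functional_extensionality_dep => Uq; apply/funext => f; exact: e.
by move: hQ; rewrite -E => hQ; rewrite (Prop_irrelevance hP hQ).
Qed.

Fact holsec_cst_subproof U (a : C R) q : oset U q -> holo q (cst a : X -> C R).
Proof. by move=> _; exact: holo_cst. Qed.

Definition holsec_cst U a := HolSec (@holsec_cst_subproof U a).

Definition mulop U (F : holsec U) : Dop U := DOp (is_diffop_fun F).

Lemma gX_cst q : (gX q (cst 0) = 0) * (gX q (cst 1) = 1) * (gX q (cst (-1)) = -1).
Proof.
have e (a : C R) : val (insubd (0 : holfun q) (cst a)) = cst a.
  by rewrite val_insubd; case: ifPn => // /asboolP[]; exact: holo_cst.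
have e0 : insubd 0 (cst 0) = 0 :> holfun q by apply: val_inj; rewrite e.
have e1 : insubd 0 (cst 1) = 1 :> holfun q by apply: val_inj; rewrite e.
have eN : insubd 0 (cst (-1)) = -1 :> holfun q by apply: val_inj; rewrite e.
pose p : {additive _ -> _} := \pi_({ideal_quot vanish (q:=q) (A:=setT) I})%qT.
rewrite /gX /germ_of e0 e1 eN; do !split.
- exact: (raddf0 p).
- exact: (rmorph1 (\pi_({ideal_quot vanish (q:=q) (A:=setT) I})%qT)).
- exact: (rmorphN1 (\pi_({ideal_quot vanish (q:=q) (A:=setT) I})%qT)).
Qed.

Fact addD_subproof U (P Q : Dop U) :
  is_diffop (fun q Uq f => dop P (q := q) Uq f + dop Q Uq f).
Proof.
exact: (is_diffop2 (op := fun W P Q q Wq f => P q Wq f + Q q Wq f)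
  (fun W => @DoAdd W) (fun V VU => erefl) (dopP P) (dopP Q)).
Qed.

Fact mulD_subproof U (P Q : Dop U) :
  is_diffop (fun q Uq f => dop P (q := q) Uq (dop Q Uq f)).
Proof.
exact: (is_diffop2 (op := fun W P Q q Wq f => P q Wq (Q q Wq f))
  (fun W => @DoMul W) (fun V VU => erefl) (dopP P) (dopP Q)).
Qed.

Definition addD U (P Q : Dop U) : Dop U := DOp (addD_subproof P Q).
Definition mulD U (P Q : Dop U) : Dop U := DOp (mulD_subproof P Q).
Definition zeroD U : Dop U := mulop (holsec_cst U 0).
Definition oneD U : Dop U := mulop (holsec_cst U 1).
Definition oppD U (P : Dop U) : Dop U := mulD (mulop (holsec_cst U (-1))) P.

HB.instance Definition _ U := gen_eqMixin (Dop U).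
HB.instance Definition _ U := gen_choiceMixin (Dop U).

Fact addDA U : associative (@addD U).
Proof. by move=> P Q T; apply: Dop_eq => q Uq f /=; rewrite addrA. Qed.
Fact addDC U : commutative (@addD U).
Proof. by move=> P Q; apply: Dop_eq => q Uq f /=; rewrite addrC. Qed.
Fact add0D U : left_id (zeroD U) (@addD U).
Proof. by move=> P; apply: Dop_eq => q Uq f /=; rewrite gX_cst mul0r add0r. Qed.
Fact addND U : left_inverse (zeroD U) (@oppD U) (@addD U).
Proof.
by move=> P; apply: Dop_eq => q Uq f /=; rewrite !gX_cst mul0r mulN1r addNr.
Qed.
Fact mulDA U : associative (@mulD U).
Proof. by move=> P Q T; apply: Dop_eq. Qed.
Fact mul1D U : left_id (oneD U) (@mulD U).
Proof. by move=> P; apply: Dop_eq => q Uq f /=; rewrite gX_cst mul1r. Qed.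
Fact mulD1 U : right_id (oneD U) (@mulD U).
Proof. by move=> P; apply: Dop_eq => q Uq f /=; rewrite gX_cst mul1r. Qed.
Fact mulDDl U : left_distributive (@mulD U) (@addD U).
Proof. by move=> P Q T; apply: Dop_eq. Qed.
Fact mulDDr U : right_distributive (@mulD U) (@addD U).
Proof.
by move=> P Q T; apply: Dop_eq => q Uq f /=; exact: is_diffop_additive (dopP P) _ _ _ _.
Qed.

HB.instance Definition _ U := GRing.isZmodule.Build (Dop U)
  (@addDA U) (@addDC U) (@add0D U) (@addND U).
(* The zero ring when U is empty. *)
HB.instance Definition _ U := GRing.Zmodule_isPzRing.Build (Dop U)
  (@mulDA U) (@mul1D U) (@mulD1 U) (@mulDDl U) (@mulDDr U).

Fact resD_subproof U V (VU : oset V `<=` oset U) (P : Dop U) :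
  is_diffop (restr VU (dop P)).
Proof.
move=> q Vq; have [W [WU [Wq gP]]] := dopP P (VU q Vq).
have s1 : oset (opensI W V) `<=` oset W by move=> x [].
have s2 : oset (opensI W V) `<=` oset V by move=> x [].
exists (opensI W V), s2; split=> //.
suff -> : restr s2 (restr VU (dop P)) = restr s1 (restr WU (dop P)).
  exact: do_generated_restr.
by apply: functional_extensionality_dep => x;
   apply: functional_extensionality_dep => Wx;
   rewrite /restr; congr (dop P _); exact: Prop_irrelevance.
Qed.

Definition resD U V (VU : oset V `<=` oset U) (P : Dop U) : Dop V :=
  DOp (resD_subproof VU P).

(** * Coherent D_X-modules *)

Record dmodule := DModule {
  sec : forall U, lmodType (Dop U);
  res : forall U V, oset V `<=` oset U -> sec U -> sec V;
  res_add : forall U V (VU : oset V `<=` oset U) s t,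
    res VU (s + t) = res VU s + res VU t;
  res_scale : forall U V (VU : oset V `<=` oset U) (P : Dop U) s,
    res VU (P *: s) = resD VU P *: res VU s;
  res_id : forall U (UU : oset U `<=` oset U) s, res UU s = s;
  res_comp : forall U V W (VU : oset V `<=` oset U) (WV : oset W `<=` oset V)
    (WU : oset W `<=` oset U) s, res WV (res VU s) = res WU s;
  sec_local : forall U (s : sec U),
    (forall q, oset U q -> exists V (VU : oset V `<=` oset U),
       oset V q /\ res VU s = 0) -> s = 0;
  sec_glue : forall U (J : Type) (V : J -> opens X)
    (VU : forall j, oset (V j) `<=` oset U) (s : forall j, sec (V j)),
    (forall q, oset U q -> exists j, oset (V j) q) ->
    (forall i j W (Wi : oset W `<=` oset (V i)) (Wj : oset W `<=` oset (V j)),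
       res Wi (s i) = res Wj (s j)) ->
    exists t : sec U, forall j, res (VU j) t = s j }.

Definition locally_fin_gen (M : dmodule) :=
  forall q, exists U, oset U q /\
  exists (r : nat) (s : 'I_r -> sec M U),
  forall W (WU : oset W `<=` oset U) (t : sec M W) x, oset W x ->
  exists W' (W'W : oset W' `<=` oset W), oset W' x /\
  exists a : 'I_r -> Dop W',
    res W'W t = \sum_i a i *: res (subset_trans W'W WU) (s i).

(* For every morphism (s_i) : D_U^r -> M|_U, the kernel is locally generated
   by finitely many sections (e_j). *)
Definition locally_fin_rel (M : dmodule) :=
  forall U (r : nat) (s : 'I_r -> sec M U) q, oset U q ->
  exists V (VU : oset V `<=` oset U), oset V q /\
  exists (k : nat) (e : 'I_k -> 'I_r -> Dop V),
  (forall j, \sum_i e j i *: res VU (s i) = 0) /\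
  forall W (WV : oset W `<=` oset V) (a : 'I_r -> Dop W),
  \sum_i a i *: res (subset_trans WV VU) (s i) = 0 ->
  forall x, oset W x ->
  exists W' (W'W : oset W' `<=` oset W), oset W' x /\
  exists b : 'I_k -> Dop W', forall i,
    resD W'W (a i) = \sum_j b j * resD (subset_trans W'W WV) (e j i).

Definition coherent (M : dmodule) := locally_fin_gen M /\ locally_fin_rel M.

(** * The V-filtration along Y *)

Definition IY Y q : set (OX q) :=
  [set f | \forall x \near q, Y x -> holval (germ_rep f) x = 0].

Fixpoint ideal_pow (A : comNzRingType) (J : set A) (k : nat) : set A :=
  if k is k'.+1 then
    [set f | exists m (a b : 'I_m -> A),
      (forall i, J (a i) /\ ideal_pow J k' (b i)) /\ f = \sum_i a i * b i]
  else setT.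

Definition IYpow Y q (i : int) : set (OX q) :=
  if i is Posz k then ideal_pow (IY Y (q := q)) k else setT.

(* Sections over [W] of V_Y^j(D_X). *)
Definition Vfil Y (j : int) W (P : Dop W) :=
  forall q (Wq : oset W q), Y q ->
  forall (i : int) f, IYpow Y i f -> IYpow Y (i - j) (dop P Wq f).

(* When Y is open near q, I_Y / I_Y^2 = 0 and the first condition is void; the
   second one then imposes the value theta = 0 of the coordinate expression
   x_1 d/dx_1 + ... + x_d d/dx_d for d = 0.  It is vacuous in positive
   codimension. *)
Definition euler_field Y T (theta : Dop T) :=
  vector_field (dop theta) /\
  forall q (Tq : oset T q), Y q ->
    (forall f, IY Y f -> IYpow Y 2 (dop theta Tq f - f)) /\
    ((\forall x \near q, Y x) -> forall f, dop theta Tq f = 0).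

(** * b-functions and indicial polynomials *)

Section Indicial.
Variables (Y : set X) (M : dmodule) (U : opens X) (u : sec M U).
Variables (d : nat) (c : chart R X n) (T : opens X) (theta : Dop T).
Variables (p : X) (Yp : Y p).

(* In the coordinates of [c], [F] is a function of x'' = (x_i)_(d <= i) only. *)
Definition depends_on_x'' W (F : X -> C R) :=
  forall x y, oset W x -> oset W y ->
    (forall i : 'I_n, (d <= i)%N -> coord c x ord0 i = coord c y ord0 i) ->
    F x = F y.

(* The ideal J_Y(u)_p of O_(Y,p)[s].  [F k] is the coefficient of s^k in f,
   as a function of x'', viewed as a function on the neighbourhood W of p. *)
Definition JY (f : {poly germ Yp}) :=
  exists W (WU : oset W `<=` oset U) (WT : oset W `<=` oset T),
  [/\ oset W p, oset W `<=` dom c &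
  exists (F : nat -> holsec W) (Q : Dop W),
  [/\ forall k, depends_on_x'' W (F k) /\ germ_of Yp (F k) = f`_k,
      Vfil Y (-1) Q &
      (\sum_(k < size f) mulop (F k) * resD WT theta ^+ k) *: res WU u
        = Q *: res WU u]].

Definition is_bfunction (b : {poly C R}) :=
  [/\ b \is monic, JY (map_poly (germ_cst Yp) b) &
      forall b' : {poly C R}, b' \is monic -> JY (map_poly (germ_cst Yp) b') ->
        (size b <= size b')%N].

Definition is_indicial (bt : {poly germ Yp}) :=
  [/\ bt \is monic, JY bt &
      forall bt', bt' \is monic -> JY bt' -> (size bt <= size bt')%N].

(* bt(s, p) *)
Definition indicial_at (bt : {poly germ Yp}) : {poly C R} :=
  map_poly (@germ_eval R n X p Y Yp) bt.

End Indicial.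

End Sheaves.

Arguments dmodule {R n} X.

(* Main.v *)
From HB Require Import structures.
From mathcomp Require Import all_boot all_order all_algebra.
From mathcomp Require Import all_classical all_reals all_analysis.
From mathcomp Require Import ring generic_quotient ring_quotient.
Require Import Defs.

(* J = JY(u)_p is an ideal of A[s], where A = O_(Y,p).  Stability under s is the
   only delicate point: theta (sum_k F_k theta^k) and sum_k F_k theta^(k+1)
   differ by sum_k theta(F_k) theta^k, and theta(F) lies in I_Y for every F.
   Indeed theta(F) x_1 = (theta(F x_1) - F x_1) - F (theta(x_1) - x_1) is in
   I_Y^2, and differentiating along x_1 shows that theta(F) vanishes on Y.

   The rest is algebra over the local ring A.  If f in J has a nonzero value
   f(s,p) of degree less than the indicial polynomial bt, then J contains a
   monic element of degree less than deg bt.  Hence the remainder of b modulo bt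
   vanishes at p, i.e. bt(s,p) divides b.  If z is a root of b = (s - z) c but
   not of bt(s,p), then bt = (s - z) q + bt(z) with bt(z) a unit of A, so that
   bt(z) c = c bt - q b is in J, contradicting the minimality of b. *)

Set Implicit Arguments.
Unset Strict Implicit.
Unset Printing Implicit Defensive.
Import Order.TTheory GRing.Theory Num.Theory.
Import numFieldNormedType.Exports.

Local Open Scope classical_set_scope.
Local Open Scope ring_scope.

(** * Monic elements of ideals over a local ring *)

Section MonicElements.
Variables (A : comNzRingType) (K : fieldType) (ev : {rmorphism A -> K}).
Hypothesis ev_unit : forall a, ev a != 0 -> exists a', a' * a = 1.
Variable J : {poly A} -> Prop.
Hypothesis JD : forall f g, J f -> J g -> J (f + g).
Hypothesis JM : forall h f, J f -> J (h * f).

(** The abstract form of [is_indicial], for a general ideal [J]. *)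
Definition least_monic (f : {poly A}) :=
  [/\ f \is monic, J f & forall g, g \is monic -> J g -> (size f <= size g)%N].

Lemma least_monic_exists f : f \is monic -> J f -> exists g, least_monic g.
Proof.
move=> mf Jf.
pose P k := `[< exists g, [/\ g \is monic, J g & size g = k] >].
have exP : exists k, P k by exists (size f); apply/asboolP; exists f.
case: (ex_minnP exP) => k /asboolP[g [mg Jg sg]] mink.
exists g; split=> // h mh Jh; rewrite sg; apply: mink.
by apply/asboolP; exists h.
Qed.

Lemma ideal_rmodp f g : J f -> J g -> g \is monic -> J (Pdiv.Ring.rmodp f g).
Proof.
move=> Jf Jg mg; have := Pdiv.RingMonic.rdivp_eq mg f.
move=> /esym/(canRL (addKr _)) ->.
by apply: JD => //; rewrite -mulNr; apply: JM.
Qed.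

(* If ev f had size e > 0, then the remainder of 'X^((size g).-1 - e) * f by g
   would have ev-image of size (size g).-1, so that its top coefficient would be
   a unit; normalizing it gives a monic element of J smaller than g. *)
Lemma map_poly_lt_least_monic g f : least_monic g -> J f ->
  (size (map_poly ev f) < size g)%N -> map_poly ev f = 0.
Proof.
move=> [mg Jg ming] Jf lt_fg; apply/eqP/negP => /negP nz_f.
have mevg : map_poly ev g \is monic by rewrite monic_map.
have sevg : size (map_poly ev g) = size g.
  by apply: size_map_poly_id0; rewrite (monicP mg) rmorph1 oner_neq0.
set e := size (map_poly ev f) in lt_fg.
have e_gt0 : (0 < e)%N by rewrite size_poly_gt0.
have [h Jh sevh] : exists2 h, J h & size (map_poly ev h) = (size g).-1.
  exists ('X^((size g).-1 - e) * f); first exact: JM.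
  rewrite rmorphM /= map_polyXn mulrC size_mulXn //.
  by rewrite subnK // -ltnS prednK // (leq_ltn_trans _ lt_fg).
have g_gt0 : (0 < size g)%N by rewrite (leq_ltn_trans _ lt_fg).
pose r := Pdiv.Ring.rmodp h g.
have Jr : J r by exact: ideal_rmodp.
have sr : (size r < size g)%N.
  by rewrite Pdiv.Ring.ltn_rmodp -size_poly_gt0.
have evr : map_poly ev r = map_poly ev h.
  have := congr1 (map_poly ev) (Pdiv.RingMonic.rdivp_eq mg h).
  rewrite rmorphD rmorphM /= -/r => evh.
  (* A nonzero image of the quotient, times the monic image of [g], would have size at least
     [size g], whereas the images of [h] and [r] are both shorter. *)
  suff q0 : map_poly ev (Pdiv.Ring.rdivp h g) = 0.
    by rewrite evh q0 mul0r add0r.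
  apply/eqP; rewrite -[_ == 0]negbK; apply/negP => nz_q.
  have : (size (map_poly ev (Pdiv.Ring.rdivp h g) * map_poly ev g)%R
          < size g)%N.
    have -> := canRL (addrK _) (esym evh).
    apply: leq_ltn_trans (size_polyD _ _) _.
    rewrite size_polyN gtn_max sevh prednK // leqnn /=.
    by apply: leq_ltn_trans sr; exact: size_poly.
  rewrite size_Mmonic // sevg; move: nz_q; rewrite -size_poly_gt0.
    by case: (size _) => // m _; rewrite addSn /= ltnNge leq_addl.
(* As [size r <= k.+1], the coefficient of [r] at [k] is the last that can be nonzero; its value
   under [ev] is the leading coefficient of the image of [h]. *)
set k := (size g).-1.-1.
have k1 : k.+1 = (size g).-1.
  by rewrite prednK // -ltnS prednK //; exact: leq_ltn_trans lt_fg.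
have /ev_unit[a ar] : ev r`_k != 0.
  rewrite -coef_map evr /k -sevh -lead_coefE lead_coef_eq0 -size_poly_gt0 sevh.
  by rewrite -k1.
have srk : (size (a%:P * r)%R <= k.+1)%N.
  rewrite mul_polyC (leq_trans (size_scale_leq _ _)) // k1 -ltnS prednK //.
have rk1 : (a%:P * r)`_k = 1 by rewrite coefCM.
have srE : size (a%:P * r) = k.+1.
  apply/eqP; rewrite eqn_leq srk ltnNge; apply/negP.
  move=> /leq_sizeP/(_ k (leqnn _)).
  by rewrite rk1 => /eqP; rewrite oner_eq0.
have := ming (a%:P * r); rewrite monicE lead_coefE srE rk1 eqxx.
move=> /(_ isT (JM _ Jr)); rewrite k1 => /leq_ltn_trans.
by move=> /(_ (size g)); rewrite prednK // ltnn => /(_ (leqnn _)).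
Qed.

(** The remainder of [f] by [g] lies in [J] and is shorter than [g], so [map_poly_lt_least_monic]
    makes its image zero. *)
Lemma dvdp_least_monic g f : least_monic g -> J f ->
  map_poly ev g %| map_poly ev f.
Proof.
move=> lg Jf; have [mg Jg _] := lg.
have Jr := ideal_rmodp Jf Jg mg.
have r0 : map_poly ev (Pdiv.Ring.rmodp f g) = 0.
  apply: (map_poly_lt_least_monic lg Jr).
  apply: leq_ltn_trans (size_poly _ _) _.
  by rewrite Pdiv.Ring.ltn_rmodp monic_neq0.
rewrite (Pdiv.RingMonic.rdivp_eq mg f) rmorphD rmorphM /= r0 addr0.
exact: dvdp_mull.
Qed.

Variable iota : {rmorphism K -> A}.
Hypothesis ev_iota : cancel iota ev.

Lemma root_least_monic g b z : least_monic g -> b \is monic ->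
    J (map_poly iota b) ->
    (forall b', b' \is monic -> J (map_poly iota b') ->
       (size b <= size b')%N) ->
  root (map_poly ev g) z = root b z.
Proof.
move=> lg mb Jb minb; have [_ Jg _] := lg.
have evb : map_poly ev (map_poly iota b) = b.
  by apply/polyP => i; rewrite !coef_map /= ev_iota.
apply/idP/idP => [gz|/factor_theorem[c bE]].
  move: gz; rewrite -!dvdp_XsubCl => /dvdp_trans; apply.
  by rewrite -[X in _ %| X]evb; exact: dvdp_least_monic.
apply: contraT => gz.
have /factor_theorem[q gE] : root (g - (g.[iota z])%:P) (iota z).
  by rewrite /root !hornerE subrr.
have /ev_unit[a agz] : ev g.[iota z] != 0.
  by move: gz; rewrite /root -[z in X in X -> _]ev_iota horner_map.
have Jc : J (map_poly iota c).
  (* Multiply [c] by [a g(z) = 1], substitute [g(z) = g - q (s - z)], and use [(s - z) c = b]. *)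
  suff -> : map_poly iota c =
      (a%:P * map_poly iota c) * g - (a%:P * q) * map_poly iota b.
    by rewrite -mulNr; apply: JD; exact: JM.
  rewrite bE rmorphM rmorphB /= map_polyX map_polyC /=.
  rewrite -[LHS]mul1r -[1]/(1%:P) -agz polyCM.
  by rewrite -[X in _ = _ * X - _](subrK (g.[iota z])%:P) gE; ring.
have mc : c \is monic.
  by move: mb; rewrite bE monicMr ?monicXsubC.
have := minb c mc Jc.
rewrite bE size_Mmonic ?monicXsubC ?monic_neq0 // size_XsubC addn2 /=.
by rewrite ltnn.
Qed.

End MonicElements.

(** * Rings of germs *)

Section GermOf.
Context {R : realType} {n : nat} {X : cmanifold R n}.
Variables (q : X) (A : set X) (Aq : A q).
Implicit Types (F G : X -> C R) (g h : germ Aq).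

Lemma germ_ofE (f : holfun q) :
  germ_of Aq f = \pi_({ideal_quot vanish Aq})%qT f.
Proof. by rewrite /germ_of valKd. Qed.

Lemma holfunE F : holo q F -> exists f : holfun q, F = f.
Proof.
move=> hF; have hF' : F \in holo_pred q by exact/asboolP.
by exists (HolFun hF').
Qed.

Lemma germ_rep_holo g : holo q (germ_rep g).
Proof. exact/asboolP/(valP (germ_rep g)). Qed.

Lemma germ_repK g : germ_of Aq (germ_rep g) = g.
Proof. by rewrite germ_ofE /germ_rep reprK. Qed.

Lemma germ_of_eq F G : holo q F -> holo q G ->
  germ_of Aq F = germ_of Aq G <-> \forall x \near q, A x -> F x = G x.
Proof.
move=> /holfunE[f ->] /holfunE[g ->]; rewrite !germ_ofE.
have -> : (\pi_({ideal_quot vanish Aq})%qT f =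
           \pi_({ideal_quot vanish Aq})%qT g) <-> f - g \in vanish Aq.
  by rewrite Quotient.idealrBE; split => /eqP.
split=> [/asboolP|] fg; last apply/asboolP.
  by apply: filterS fg => x /[apply] /subr0_eq.
by apply: filterS fg => x /[apply] e; apply/eqP; rewrite subr_eq0; exact/eqP.
Qed.

Lemma germ_ofB F G : holo q F -> holo q G ->
  germ_of Aq (F - G) = germ_of Aq F - germ_of Aq G.
Proof.
move=> /holfunE[f ->] /holfunE[g ->].
by rewrite -[RHS](_ : germ_of Aq (f - g) = _) // !germ_ofE rmorphB.
Qed.

Lemma germ_ofM F G : holo q F -> holo q G ->
  germ_of Aq (F * G) = germ_of Aq F * germ_of Aq G.
Proof.
move=> /holfunE[f ->] /holfunE[g ->].
by rewrite -[RHS](_ : germ_of Aq (f * g) = _) // !germ_ofE rmorphM.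
Qed.

Lemma germ_of1 : germ_of Aq (1 : X -> C R) = 1.
Proof.
by rewrite -[RHS](_ : germ_of Aq (1 : holfun q) = _) // germ_ofE rmorph1.
Qed.

Lemma germ_of0 : germ_of Aq (0 : X -> C R) = 0.
Proof.
by rewrite -[RHS](_ : germ_of Aq (0 : holfun q) = _) // germ_ofE rmorph0.
Qed.

Lemma holoD F G : holo q F -> holo q G -> holo q (F + G).
Proof.
by move=> /holfunE[f ->] /holfunE[g ->]; exact/asboolP/(valP (f + g)).
Qed.

Lemma germ_ofD F G : holo q F -> holo q G ->
  germ_of Aq (F + G) = germ_of Aq F + germ_of Aq G.
Proof.
move=> /holfunE[f ->] /holfunE[g ->].
by rewrite -[RHS](_ : germ_of Aq (f + g) = _) // !germ_ofE rmorphD.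
Qed.

Lemma germ_ofP g F : holo q F ->
  germ_of Aq F = g <-> \forall x \near q, A x -> germ_rep g x = F x.
Proof.
move=> hF; rewrite -{1}[g]germ_repK; apply: iff_trans _ _.
  exact: (germ_of_eq hF (germ_rep_holo g)).
by split; apply: filterS => x /[apply].
Qed.

(** The chosen representative agrees with [F] at the points of [A] near [q], and [q] itself lies in
    [A]. *)
Lemma germ_eval_of F : holo q F -> germ_eval (germ_of Aq F) = F q.
Proof.
move=> hF; have /(germ_ofP _ hF)/nbhs_singleton := erefl (germ_of Aq F).
exact.
Qed.

Fact germ_eval_zmod_morphism : zmod_morphism (@germ_eval R n X q A Aq).
Proof.
move=> g h; rewrite -[g in LHS]germ_repK -[h in LHS]germ_repK.
have [hg hh] := (germ_rep_holo g, germ_rep_holo h).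
by rewrite -germ_ofB // germ_eval_of //; exact: holoB.
Qed.

Fact germ_eval_monoid_morphism : monoid_morphism (@germ_eval R n X q A Aq).
Proof.
split; first by rewrite -germ_of1 germ_eval_of //; exact: (@holo_cst _ _ _ _ 1).
move=> g h; rewrite -[g in LHS]germ_repK -[h in LHS]germ_repK.
have [hg hh] := (germ_rep_holo g, germ_rep_holo h).
by rewrite -germ_ofM // germ_eval_of //; exact: holoM.
Qed.

Fact germ_cst_zmod_morphism : zmod_morphism (@germ_cst R n X q A Aq).
Proof. by move=> a b; rewrite /germ_cst -germ_ofB; [|exact: holo_cst..]. Qed.

Fact germ_cst_monoid_morphism : monoid_morphism (@germ_cst R n X q A Aq).
Proof.
split=> [|a b]; first exact: germ_of1.
by rewrite /germ_cst -germ_ofM //; exact: holo_cst.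
Qed.

Lemma germ_cstK : cancel (@germ_cst R n X q A Aq) (@germ_eval R n X q A Aq).
Proof. by move=> a; rewrite germ_eval_of //; exact: holo_cst. Qed.

End GermOf.

HB.instance Definition _ R n (X : cmanifold R n) (q : X) (A : set X)
  (Aq : A q) :=
  GRing.isZmodMorphism.Build (germ Aq) (C R) (@germ_eval R n X q A Aq)
    (@germ_eval_zmod_morphism R n X q A Aq).
HB.instance Definition _ R n (X : cmanifold R n) (q : X) (A : set X)
  (Aq : A q) :=
  GRing.isMonoidMorphism.Build (germ Aq) (C R) (@germ_eval R n X q A Aq)
    (@germ_eval_monoid_morphism R n X q A Aq).
HB.instance Definition _ R n (X : cmanifold R n) (q : X) (A : set X)
  (Aq : A q) :=
  GRing.isZmodMorphism.Build (C R) (germ Aq) (@germ_cst R n X q A Aq)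
    (@germ_cst_zmod_morphism R n X q A Aq).
HB.instance Definition _ R n (X : cmanifold R n) (q : X) (A : set X)
  (Aq : A q) :=
  GRing.isMonoidMorphism.Build (C R) (germ Aq) (@germ_cst R n X q A Aq)
    (@germ_cst_monoid_morphism R n X q A Aq).

(** * Holomorphic functions in charts *)

(** The first-order expansion of [f] at [x] is also one of [g], so uniqueness identifies the
    differential of [g] with that of [f]. *)
Lemma near_eq_differentiable (K : numFieldType) (V W : normedModType K)
    (f g : V -> W) (x : V) :
  (\forall y \near x, f y = g y) -> differentiable f x -> differentiable g x.
Proof.
move=> fg /diff_locallyP[cdf /eqaddoP df].
have fg0 : \forall y \near (0 : V), f (y + x) = g (y + x).
  rewrite (near_shift x 0) /= sub0r.
  by apply: filterS fg => y; rewrite /= subrK.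
have dg : g \o shift x = cst (g x) + 'd f x +o_ 0 id.
  apply/eqaddoP => e e0; have := df e e0; apply: filterS2 fg0 => y fgy.
  rewrite -[(_ - _) y]/(f (y + x) - (f x + 'd f x y)) fgy.
  by rewrite (nbhs_singleton fg).
by apply/diff_locallyP; rewrite (diff_unique cdf dg).
Qed.

Section Charts.
Context {R : realType} {n : nat} {X : cmanifold R n}.
Implicit Types (q : X) (c : chart R X n) (f : X -> C R).

Lemma near_coord c q (P : set X) : dom c q ->
  (\forall x \near q, P x) -> \forall z \near coord c q, P (param c z).
Proof. by move=> cq Pq; apply: (param_cont cq); rewrite coordK. Qed.

Lemma near_param c q (P : set 'rV[C R]_n) : dom c q ->
  (\forall z \near coord c q, P z) -> \forall x \near q, P (coord c x).
Proof. by move=> cq; have := coord_cont cq; apply. Qed.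

Lemma near_dom c q : dom c q -> \forall x \near q, dom c x.
Proof. by move=> cq; exact: open_nbhs_nbhs (conj (dom_open c) cq). Qed.

Lemma near_paramK c q : dom c q ->
  \forall z \near coord c q, coord c (param c z) = z.
Proof.
move=> cq.
have : \forall z \near coord c q, (coord c @` dom c) z.
  by apply: open_nbhs_nbhs; split; [exact: coord_open|exists q].
by apply: filterS => _ [x cx <-]; rewrite coordK.
Qed.

(** Near [coord c q], the map [f \o param c] is [f \o param c'] composed with the transition map. *)
Lemma holo_trans_near c c' q f : holo_trans c c' -> dom c q -> dom c' q ->
  (\forall z \near coord c' q, differentiable (f \o param c') z) ->
  \forall z \near coord c q, differentiable (f \o param c) z.
Proof.
move=> cc' cq c'q df.
have c'z : \forall z \near coord c q, dom c' (param c z).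
  exact: (near_coord cq (near_dom c'q)).
near=> z.
have cz : dom c (param c z) by near: z; exact: near_coord cq (near_dom cq).
have zK : coord c (param c z) = z by near: z; exact: near_paramK.
apply: (@near_eq_differentiable _ _ _
          ((f \o param c') \o (coord c' \o param c))).
  have : \forall w \near z, dom c' (param c w).
    by near: z; exact: near_join c'z.
  by apply: filterS => w c'w; rewrite /= coordK.
apply: differentiable_comp.
  rewrite -[X in differentiable _ X]zK; apply: cc' => //.
  by near: z.
near: z.
exact: (near_coord cq (near_param c'q df)).
Unshelve. all: by end_near. Qed.

Lemma atlas_holo_chart c : atlas c -> holo_chart c.
Proof. by move=> ac c' ac'; split; exact: atlas_compat. Qed.

(** Holomorphy is defined through the charts of the atlas; this reduces it to a single chart of the
    maximal atlas, in particular to an adapted one. *)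
Lemma holoP c q f : holo_chart c -> dom c q ->
  holo q f <-> \forall z \near coord c q, differentiable (f \o param c) z.
Proof.
move=> hc cq; split=> [hf|df c' /hc[? ?] c'q]; last exact: holo_trans_near df.
have [c' ac' c'q] := atlas_cover q; have [? ?] := hc c' ac'.
exact: holo_trans_near (hf c' ac' c'q).
Qed.

Lemma holo_near q f : holo q f -> \forall x \near q, holo x f.
Proof.
have [c ac cq] := atlas_cover q; have hc := atlas_holo_chart ac.
move=> /(holoP _ hc cq)/near_join/(near_param cq) df.
near=> x; apply/(holoP _ hc (near (near_dom cq) x _)) => //.
by near: x.
Unshelve. all: by end_near. Qed.

Lemma holo_neq0_near q f : holo q f -> f q != 0 -> \forall x \near q, f x != 0.
Proof.
move=> hf fq; have [c ac cq] := atlas_cover q.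
move/(holoP _ (atlas_holo_chart ac) cq)/nbhs_singleton: hf.
move=> /differentiable_continuous/cvgr_neq0; rewrite /= coordK //.
move=> /(_ fq)/(near_param cq); apply: filterS2 (near_dom cq) => x cx.
by rewrite coordK.
Qed.

Lemma holoV q f : holo q f -> f q != 0 -> holo q (fun x => (f x)^-1).
Proof.
move=> hf fq c ac cq; have := near_coord cq (holo_neq0_near hf fq).
by apply: filterS2 (hf c ac cq) => z dz nz; exact: (differentiableV dz nz).
Qed.

Lemma holo_coord c q i : holo_chart c -> dom c q ->
  holo q (fun x => coord c x ord0 i).
Proof.
move=> hc cq; apply/(holoP _ hc cq).
have := near_join (near_paramK cq); apply: filterS => z zK.
apply: (@near_eq_differentiable _ _ _ (fun w : 'rV[C R]_n => w ord0 i)).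
  by apply: filterS zK => w /= ->.
exact: differentiable_coord.
Qed.

End Charts.

(** * The ideal of Y *)

Lemma derive_coord (K : numFieldType) n (v x : 'rV[K]_n) i :
  'D_v (fun w : 'rV[K]_n => w ord0 i : K) x = v ord0 i.
Proof.
apply: cvg_lim => //; apply: cvg_near_cst.
near=> h; have h0 : h != 0 by near: h; exact: nbhs_dnbhs_neq.
by rewrite /= !mxE addrK; exact: mulKf.
Unshelve. all: by end_near. Qed.

(** A representative that is nonzero at [q] stays nonzero nearby, so its reciprocal is holomorphic
    there. This is the locality of the ring of germs. *)
Lemma germ_unit R n (X : cmanifold R n) (q : X) (A : set X) (Aq : A q)
    (g : germ Aq) : germ_eval g != 0 -> exists g', g' * g = 1.
Proof.
move=> gq; have hg := germ_rep_holo g; have hV := holoV hg gq.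
exists (germ_of Aq (fun x => (germ_rep g x)^-1)).
rewrite -[g in _ * g]germ_repK -germ_ofM // -germ_of1.
apply/germ_of_eq; [exact: holoM|exact: (@holo_cst _ _ _ _ 1)|].
by apply: filterS (holo_neq0_near hg gq) => x gx _; exact: mulVf.
Qed.

(** * Powers of an ideal *)

Section IdealPowers.
Variables (A : comNzRingType) (J : set A).
Hypothesis J0 : J 0.
Hypothesis JD : forall a b, J a -> J b -> J (a + b).
Hypothesis JM : forall a b, J b -> J (a * b).

Lemma ideal_pow0 k : ideal_pow J k 0.
Proof.
case: k => [//|k]; exists 0%N, (fun=> 0), (fun=> 0).
by split=> [[]//|]; rewrite big_ord0.
Qed.

Lemma ideal_powD k a b :
  ideal_pow J k a -> ideal_pow J k b -> ideal_pow J k (a + b).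
Proof.
case: k => [//|k] [m1 [a1 [b1 [h1 ->]]]] [m2 [a2 [b2 [h2 ->]]]].
exists (m1 + m2)%N,
  (fun i => match fintype.split i with inl j => a1 j | inr j => a2 j end),
  (fun i => match fintype.split i with inl j => b1 j | inr j => b2 j end).
split=> [i|]; first by case: (fintype.split i).
by rewrite big_split_ord /=; congr (_ + _); apply: eq_bigr => i _;
   rewrite ?(unsplitK (inl i)) ?(unsplitK (inr i)).
Qed.

Lemma ideal_pow_mulS k a b : J a -> ideal_pow J k b -> ideal_pow J k.+1 (a * b).
Proof.
move=> Ja Jb; exists 1%N, (fun=> a), (fun=> b).
by split=> [//|]; rewrite big_ord1.
Qed.

Lemma ideal_pow_sum k m (f : 'I_m -> A) :
  (forall i, ideal_pow J k (f i)) -> ideal_pow J k (\sum_i f i).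
Proof.
by move=> hf; elim/big_ind: _ => //; [exact: ideal_pow0|exact: ideal_powD].
Qed.

Lemma ideal_powM k a b : ideal_pow J k b -> ideal_pow J k (a * b).
Proof.
case: k => [//|k] [m [a1 [b1 [h1 ->]]]]; rewrite mulr_sumr.
apply: ideal_pow_sum => i; have [? ?] := h1 i.
by rewrite mulrA; apply: ideal_pow_mulS => //; exact: JM.
Qed.

Lemma ideal_pow2_sub a : ideal_pow J 2 a -> J a.
Proof.
move=> [m [a1 [b1 [h1 ->]]]]; elim/big_ind: _ => // i _.
by rewrite mulrC; apply: JM; have [] := h1 i.
Qed.

(** Induction on [k]: in D(a b) = D(a) b + a D(b) both terms are a member of J times a member of the
    preceding power. *)
Lemma ideal_pow_derivation (D : A -> A) k :
    (forall a b, D (a + b) = D a + D b) ->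
    (forall a b, D (a * b) = D a * b + a * D b) ->
    (forall a, J a -> J (D a)) ->
  forall a, ideal_pow J k a -> ideal_pow J k (D a).
Proof.
move=> DD DM DJ; elim: k => [//|k IHk] _ [m [a [b [h ->]]]].
have D0 : D 0 = 0.
  by apply: (addrI (D 0)); rewrite -DD !addr0.
rewrite (big_morph D DD D0); apply: ideal_pow_sum => i.
have [Ja Jb] := h i; rewrite DM.
by apply: ideal_powD; apply: ideal_pow_mulS => //; [exact: DJ|exact: IHk].
Qed.

End IdealPowers.

(** * Germs vanishing on Y *)

Section VanishingIdeal.
Context {R : realType} {n : nat} {X : cmanifold R n}.
Variables (Y : set X) (q : X).
Implicit Types (F G : X -> C R) (f g : OX q).

Lemma gX_surj g : exists F, holo q F /\ g = gX q F.
Proof.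
by exists (germ_rep g); split; [exact: germ_rep_holo|rewrite /gX germ_repK].
Qed.

Lemma gX_eq F G : holo q F -> holo q G ->
  gX q F = gX q G <-> \forall x \near q, F x = G x.
Proof.
move=> hF hG; apply: iff_trans (germ_of_eq I hF hG) _.
by split; apply: filterS => x; [apply|].
Qed.

Lemma gXD F G : holo q F -> holo q G -> gX q (F + G) = gX q F + gX q G.
Proof. exact: germ_ofD. Qed.

Lemma gXM F G : holo q F -> holo q G -> gX q (F * G) = gX q F * gX q G.
Proof. exact: germ_ofM. Qed.

Lemma IYP F : holo q F -> IY Y (gX q F) <-> \forall x \near q, Y x -> F x = 0.
Proof.
move=> hF; have /(germ_ofP _ hF) e := erefl (gX q F).
by split; apply: filterS2 e => x /(_ I) ->.
Qed.

Lemma IY0 : IY Y (0 : OX q).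
Proof.
rewrite -(germ_of0 (q := q) (A := setT) I); apply/(IYP (@holo_cst _ _ _ q 0)).
exact: nearW.
Qed.

Lemma IYD f g : IY Y f -> IY Y g -> IY Y (f + g).
Proof.
have [F [hF ->]] := gX_surj f; have [G [hG ->]] := gX_surj g.
move=> /(IYP hF) zF /(IYP hG) zG; rewrite -gXD //.
apply/IYP; first exact: holoD.
apply: filterS2 zF zG => x zF zG Yx.
by rewrite -[LHS]/(F x + G x) zF // zG // addr0.
Qed.

Lemma IYM f g : IY Y g -> IY Y (f * g).
Proof.
have [F [hF ->]] := gX_surj f; have [G [hG ->]] := gX_surj g.
move=> /(IYP hG) zG; rewrite -gXM //; apply/IYP; first exact: holoM.
by apply: filterS zG => x zG Yx; rewrite -[LHS]/(F x * G x) zG // mulr0.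
Qed.

Lemma IYpowD i f g : IYpow Y i f -> IYpow Y i g -> IYpow Y i (f + g).
Proof. by case: i => // k; exact: ideal_powD. Qed.

Lemma IYpowM i f g : IYpow Y i g -> IYpow Y i (f * g).
Proof. by case: i => // k; apply: ideal_powM => *; exact: IYM. Qed.

(** For [i < 0] the exponent [i + 1] is at most 0 and the target is the whole ring. *)
Lemma IYpow_mulS i f g : IY Y f -> IYpow Y i g -> IYpow Y (i + 1) (f * g).
Proof.
case: i => [k|[|k]] // If Ig; rewrite -PoszD addn1.
exact: ideal_pow_mulS.
Qed.

(** First-order vanishing on [Y] in the direction [v], the trace of membership in I_Y^2 that is used
    below. Differentiability is included so that the rule for the derivative of a sum applies. *)
Definition flat (c : chart R X n) (v : 'rV[C R]_n) F :=
  \forall x \near q, Y x -> [/\ F x = 0,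
    differentiable (F \o param c) (coord c x) &
    'D_v (F \o param c) (coord c x) = 0].

(** * First-order vanishing of the elements of I_Y^2 *)

Section Flat.
Variables (c : chart R X n) (v : 'rV[C R]_n).
Hypotheses (hc : holo_chart c) (cq : dom c q).

Let nearF F (hF : holo q F) :
  \forall x \near q, differentiable (F \o param c) (coord c x) :=
  near_param cq ((holoP F hc cq).1 hF).

Lemma flat_eq F G : (\forall x \near q, F x = G x) -> flat c v F -> flat c v G.
Proof.
move=> FG fF; have FGc := near_param cq (near_join (near_coord cq FG)).
move: FG fF FGc; apply: filterS3 => x FGx fF FGc Yx; have [Fx dF DF] := fF Yx.
split; first by rewrite -FGx.
- exact: near_eq_differentiable dF.
- by rewrite -DF; apply/near_eq_derive; apply: filterS FGc => y /esym.
Qed.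

Lemma flatD F G : flat c v F -> flat c v G -> flat c v (F + G).
Proof.
apply: filterS2 => x hF hG Yx.
have [//|Fx dF DF] := hF _; have [//|Gx dG DG] := hG _; split.
- by rewrite -[LHS]/(F x + G x) Fx Gx addr0.
- exact: (differentiableD dF dG).
- rewrite -[(F + G) \o _]/((F \o param c) + (G \o param c)).
  by rewrite deriveD ?DF ?DG ?addr0 //; exact: diff_derivable.
Qed.

Lemma derive_mul F G x : dom c x ->
  differentiable (F \o param c) (coord c x) ->
  differentiable (G \o param c) (coord c x) ->
  'D_v ((F * G) \o param c) (coord c x) =
  F x * 'D_v (G \o param c) (coord c x) + G x * 'D_v (F \o param c) (coord c x).
Proof.
move=> cx dF dG.
rewrite -[(F * G) \o _]/((F \o param c) * (G \o param c)).
by rewrite deriveM; [rewrite /= coordK|exact: diff_derivable..].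
Qed.

(** By the product rule each term of the derivative keeps a factor that vanishes on [Y]. *)
Lemma flatM F G : holo q F -> holo q G -> IY Y (gX q F) -> IY Y (gX q G) ->
  flat c v (F * G).
Proof.
move=> hF hG /(IYP hF) zF /(IYP hG) zG.
have [dF dG] := (nearF hF, nearF hG).
near=> x => Yx.
have Fx : F x = 0 by have := Yx; near: x.
have Gx : G x = 0 by have := Yx; near: x.
have cx : dom c x by near: x; exact: near_dom.
have dFx : differentiable (F \o param c) (coord c x) by near: x.
have dGx : differentiable (G \o param c) (coord c x) by near: x.
split; first by rewrite -[LHS]/(F x * G x) Fx mul0r.
- exact: (differentiableM dFx dGx).
- apply: etrans (derive_mul cx dFx dGx) _.
  by rewrite Fx Gx [X in X + _]mul0r [X in _ + X]mul0r addr0.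
Unshelve. all: by end_near. Qed.

(** Flatness depends only on the germ, passes to sums, and holds for products of two elements of
    I_Y. *)
Lemma IYpow2_flat F : holo q F -> IYpow Y 2 (gX q F) -> flat c v F.
Proof.
move=> hF [m [a [b [ab eF]]]].
suff [G [hG eG fG]] : exists G, [/\ holo q G, gX q F = gX q G & flat c v G].
  by apply: flat_eq fG; apply/gX_eq => //; exact/esym.
rewrite eF; elim/big_ind: _ => [|_ _ [F1 [hF1 -> f1]] [F2 [hF2 -> f2]]|i _].
- exists 0; split; first exact: (@holo_cst _ _ _ _ 0).
    by rewrite /gX germ_of0.
  apply: nearW => x Yx; rewrite -[(0 : X -> C R) \o _]/(cst 0).
  by split; [|exact: differentiable_cst|exact: derive_cst].
- by exists (F1 + F2); split; [exact: holoD|rewrite gXD|exact: flatD].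
- have [Ia Ib] := ab i.
  (* The first power in [ideal_pow] is a set of sums of products whose second factor is arbitrary;
     these sums lie in [IY]. *)
  have {}Ib : IY Y (b i).
    case: Ib => k [a' [b' [ab' ->]]]; elim/big_ind: _ => [||j _].
    + exact: IY0.
    + exact: IYD.
    + by rewrite mulrC; apply: IYM; have [] := ab' j.
  have [G [hG eG]] := gX_surj (a i); have [H [hH eH]] := gX_surj (b i).
  rewrite eG eH in Ia Ib *.
  by exists (G * H); split; [exact: holoM|rewrite gXM|exact: flatM].
Qed.

(** At a point of [Y], where x_i = 0, the derivative of G x_i along [v] is G times the derivative of
    x_i, that is, G itself; it vanishes by flatness. *)
Lemma IY_of_mul_coord d (i : 'I_n) g : adapted_chart Y d c -> (i < d)%N ->
  v ord0 i = 1 ->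
  IYpow Y 2 (g * gX q (fun x => coord c x ord0 i)) -> IY Y g.
Proof.
move=> [_ _ Yc] id vi; have [G [hG ->]] := gX_surj g.
have hx := holo_coord i hc cq.
rewrite -gXM // => /(IYpow2_flat (holoM hG hx)) fG; apply/(IYP hG).
have [dG dx] := (nearF hG, nearF hx).
have xK := near_param cq (near_join (near_paramK cq)).
near=> x => Yx.
have cx : dom c x by near: x; exact: near_dom.
have dGx : differentiable (G \o param c) (coord c x) by near: x.
have dxx : differentiable ((fun x => coord c x ord0 i) \o param c) (coord c x).
  by near: x.
have : 'D_v ((G * (fun x => coord c x ord0 i)) \o param c) (coord c x) = 0.
  by have := Yx; near: x; apply: filterS fG => x /[apply] -[].
rewrite derive_mul //.
have -> : coord c x ord0 i = 0 by have /(Yc _ cx)/(_ i id) := Yx.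
have -> : 'D_v ((fun y : X => coord c y ord0 i) \o param c) (coord c x) = 1.
  rewrite -vi -(derive_coord v (coord c x)); apply: near_eq_derive.
  have : \forall z \near coord c x, coord c (param c z) = z by near: x.
  by apply: filterS => z /= ->.
by rewrite mulr1 mul0r addr0.
Unshelve. all: by end_near. Qed.

End Flat.

End VanishingIdeal.

(** * Operators and the V-filtration *)

Section Operators.
Context {R : realType} {n : nat} {X : cmanifold R n}.
Implicit Types (q : X) (U V W T : opens X) (Y : set X).

Lemma resDD U V (VU : oset V `<=` oset U) : {morph resD VU : P Q / P + Q}.
Proof. by move=> P Q; exact: Dop_eq. Qed.

Lemma resDM U V (VU : oset V `<=` oset U) : {morph resD VU : P Q / P * Q}.
Proof. by move=> P Q; exact: Dop_eq. Qed.

Lemma resD0 U V (VU : oset V `<=` oset U) : resD VU 0 = 0.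
Proof. exact: Dop_eq. Qed.

Lemma resDX U V (VU : oset V `<=` oset U) P k :
  resD VU (P ^+ k) = resD VU P ^+ k.
Proof.
elim: k => [|k IHk]; first exact: Dop_eq.
by rewrite !exprS resDM IHk.
Qed.

Lemma resD_comp U V W (VU : oset V `<=` oset U) (WV : oset W `<=` oset V)
    (WU : oset W `<=` oset U) P : resD WV (resD VU P) = resD WU P.
Proof.
apply: Dop_eq => q Wq f.
by rewrite /= /restr (Prop_irrelevance (VU q _) (WU q Wq)).
Qed.

Definition holsec_res U V (VU : oset V `<=` oset U) (F : holsec U) : holsec V :=
  HolSec (fun q Vq => hsvalP F (VU q Vq)).

Lemma resD_mulop U V (VU : oset V `<=` oset U) (F : holsec U) :
  resD VU (mulop F) = mulop (holsec_res VU F).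
Proof. exact: Dop_eq. Qed.

Definition holsecD W (F G : holsec W) : holsec W :=
  HolSec (fun q Wq => holoD (hsvalP F Wq) (hsvalP G Wq)).
Definition holsecB W (F G : holsec W) : holsec W :=
  HolSec (fun q Wq => holoB (hsvalP F Wq) (hsvalP G Wq)).
Definition holsecM W (F G : holsec W) : holsec W :=
  HolSec (fun q Wq => holoM (hsvalP F Wq) (hsvalP G Wq)).

Lemma mulopD W (F G : holsec W) : mulop (holsecD F G) = mulop F + mulop G.
Proof.
apply: Dop_eq => q Wq f.
by rewrite -[LHS]/(gX q (F \+ G) * f) gXD ?mulrDl //; exact: hsvalP.
Qed.

Lemma mulopB W (F G : holsec W) : mulop (holsecB F G) = mulop F - mulop G.
Proof.
apply/(addIr (mulop G)); rewrite subrK -mulopD.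
by apply: Dop_eq => q Wq f /=; congr (gX q _ * f); rewrite subrK.
Qed.

Lemma mulopM W (F G : holsec W) : mulop (holsecM F G) = mulop F * mulop G.
Proof.
apply: Dop_eq => q Wq f.
rewrite -[LHS]/(gX q ((F : X -> C R) * (G : X -> C R)) * f).
by rewrite gXM -?mulrA //; exact: hsvalP.
Qed.

Lemma opens_shrink W q (P : set X) : oset W q -> (\forall x \near q, P x) ->
  exists V : opens X, [/\ oset V `<=` oset W, oset V q & oset V `<=` P].
Proof.
move=> Wq Pq.
exists (Opens (openI (oset_open W) (open_interior P))); split=> [x []||x []] //.
by move=> _ /interior_subset.
Qed.

Section Vfiltration.
Variables (Y : set X).

Lemma VfilD W j (P Q : Dop W) : Vfil Y j P -> Vfil Y j Q -> Vfil Y j (P + Q).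
Proof.
by move=> hP hQ q Wq Yq i f If; apply: IYpowD; [exact: hP|exact: hQ].
Qed.

Lemma VfilM W j k (P Q : Dop W) :
  Vfil Y j P -> Vfil Y k Q -> Vfil Y (j + k) (P * Q).
Proof.
move=> hP hQ q Wq Yq i f If; rewrite opprD addrCA addrC.
by apply: hP => //; apply: hQ.
Qed.

Lemma Vfil_mulop W (F : holsec W) : Vfil Y 0 (mulop F).
Proof. by move=> q Wq Yq i f If; rewrite subr0; exact: IYpowM. Qed.

Lemma VfilN W j (P : Dop W) : Vfil Y j P -> Vfil Y j (- P).
Proof.
move=> hP; rewrite -[- P]/(mulop (holsec_cst W (-1)) * P) -[j]add0r.
by apply: VfilM => //; exact: Vfil_mulop.
Qed.

(** Multiplication by an element of I_Y raises the I_Y-adic order by one. Hence modulo V^{-1} only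
    the values of a coefficient on [Y] matter. *)
Lemma Vfil_mulop_vanish W (F : holsec W) :
  (forall x, oset W x -> Y x -> F x = 0) -> Vfil Y (-1) (mulop F).
Proof.
move=> F0 q Wq Yq i f If; rewrite opprK; apply: IYpow_mulS => //.
apply/(IYP _ (hsvalP F Wq)).
by apply: filterS (open_nbhs_nbhs (conj (oset_open W) Wq)) => x; exact: F0.
Qed.


Lemma Vfil_res W V (VW : oset V `<=` oset W) j (P : Dop W) :
  Vfil Y j P -> Vfil Y j (resD VW P).
Proof. by move=> hP q Vq Yq i f If; exact: hP. Qed.

Lemma VfilX W (P : Dop W) k : Vfil Y 0 P -> Vfil Y 0 (P ^+ k).
Proof.
move=> hP; elim: k => [|k IHk]; first exact: Vfil_mulop.
by rewrite exprS -[0]addr0; exact: VfilM.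
Qed.

Lemma Vfil_sum W j m (P : 'I_m -> Dop W) : (forall i, Vfil Y j (P i)) ->
  Vfil Y j (\sum_i P i).
Proof.
move=> hP; elim/big_ind: _ => // [|P1 P2]; last exact: VfilD.
move=> q Wq Yq i f If /=; rewrite gX_cst mul0r.
case: (i - j) => // k; exact: ideal_pow0.
Qed.

(** * The position of theta in the V-filtration *)

Section EulerField.
Variables (T : opens X) (theta : Dop T).
Hypothesis htheta : euler_field Y theta.

Lemma euler_fieldD q (Tq : oset T q) f g :
  dop theta Tq (f + g) = dop theta Tq f + dop theta Tq g.
Proof. exact: is_diffop_additive (dopP theta) _ _ _ _. Qed.

Lemma euler_fieldM q (Tq : oset T q) f g :
  dop theta Tq (f * g) = dop theta Tq f * g + f * dop theta Tq g.
Proof. by have [[_ + _] _] := htheta; apply. Qed.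

Lemma euler_field_IY q (Tq : oset T q) f : Y q ->
  IY Y f -> IY Y (dop theta Tq f).
Proof.
move=> Yq If; have [_ /(_ q Tq Yq)[+ _]] := htheta => /(_ f If) th.
rewrite -[dop _ _ _](subrK f); apply: IYD => //.
apply: ideal_pow2_sub th => *; [exact: IY0|exact: IYD|exact: IYM].
Qed.

(** As theta(f) - f is in I_Y^2 for f in I_Y, the derivation theta preserves I_Y, hence all its
    powers. *)
Lemma Vfil_euler_field : Vfil Y 0 theta.
Proof.
move=> q Tq Yq i f; rewrite subr0; case: i => // k.
apply: ideal_pow_derivation => [g h|g h|g].
- exact: euler_fieldD.
- exact: euler_fieldM.
- exact: euler_field_IY.
Qed.

Lemma euler_field_sub_IY (c : chart R X n) d q (Tq : oset T q) g :
  adapted_chart Y d c -> dom c q -> Y q -> IY Y (dop theta Tq g).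
Proof.
move=> hc cq Yq; have [_ /(_ q Tq Yq)[th thY]] := htheta.
(* For [d = 0] there is no coordinate x_1 to multiply by; then [Y] is a neighborhood of [q], and the
   second clause of [euler_field] gives theta = 0. *)
have [dn hol Yc] := hc; case: (posnP d) => [d0|d_gt0].
  rewrite thY; first exact: IY0.
  by apply: filterS (near_dom cq) => x cx; apply/(Yc x cx) => i; rewrite d0.
pose i := Ordinal (leq_trans d_gt0 dn).
pose x := gX q (fun y => coord c y ord0 i).
have Ix : IY Y x.
  apply/(IYP _ (holo_coord i hol cq)).
  by apply: filterS (near_dom cq) => y cy /(Yc y cy)/(_ i d_gt0).
(* Any direction with component 1 along x_1 serves; the all-ones vector is one. *)
apply: (IY_of_mul_coord (v := const_mx 1) hol cq hc (i := i) d_gt0).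
  by rewrite mxE.
have -> : dop theta Tq g * gX q (fun x0 : X => coord c x0 ord0 i) =
   (dop theta Tq (g * x) - g * x) + (- g) * (dop theta Tq x - x).
  by rewrite euler_fieldM; rewrite -/x; ring.
apply: IYpowD; first by apply: th; exact: IYM.
by apply: IYpowM; exact: th.
Qed.

(** By the Leibniz rule the commutator is multiplication by theta(F), an element of I_Y by
    [euler_field_sub_IY]. *)
Lemma Vfil_euler_comm (c : chart R X n) d (F : holsec T) :
  adapted_chart Y d c -> oset T `<=` dom c ->
  Vfil Y (-1) (theta * mulop F - mulop F * theta).
Proof.
move=> hc Tc q Tq Yq i f If; rewrite opprK.
have -> : dop (theta * mulop F - mulop F * theta) Tq f =
    dop theta Tq (gX q F) * f.
  rewrite -[LHS]/(dop theta Tq (gX q F * f) +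
    gX q (cst (-1)) * (gX q F * dop theta Tq f)).
  by rewrite euler_fieldM gX_cst; ring.
by apply: IYpow_mulS => //; apply: euler_field_sub_IY hc _ Yq; exact: Tc.
Qed.

End EulerField.

Lemma euler_field_res T V (VT : oset V `<=` oset T) (theta : Dop T) :
  euler_field Y theta -> euler_field Y (resD VT theta).
Proof.
move=> [vth eth]; split; first exact: vector_field_restr.
by move=> q Vq; exact: eth.
Qed.

End Vfiltration.

End Operators.

(** * The ideal JY *)

Section Retraction.
Context {R : realType} {n : nat} {X : cmanifold R n}.
Variables (Y : set X) (d : nat) (c : chart R X n) (p : X).
Hypotheses (hc : adapted_chart Y d c) (cp : dom c p) (Yp : Y p).

Definition drop_x' (z : 'rV[C R]_n) : 'rV[C R]_n :=
  \row_i if (i < d)%N then 0 else z ord0 i.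

Lemma differentiable_drop_x' z : differentiable drop_x' z.
Proof.
have -> : drop_x' = \sum_(i < n) (fun w : 'rV[C R]_n =>
    (if (i < d)%N then 0 else w ord0 i) *: (delta_mx ord0 i : 'rV[C R]_n)).
  apply/funext => w; rewrite fct_sumE [LHS]row_sum_delta.
  by apply: eq_bigr => i _; rewrite mxE.
apply: differentiable_sum => i; apply: differentiableZl.
by case: (i < d)%N; [exact: differentiable_cst|exact: differentiable_coord].
Qed.

Lemma drop_x'_coord x : dom c x -> Y x -> drop_x' (coord c x) = coord c x.
Proof.
move=> cx Yx; have [_ _ /(_ x cx)[/(_ Yx) x0 _]] := hc.
by apply/rowP => i; rewrite mxE; case: ifP => // /x0 ->.
Qed.

(** Composition with the coordinate projection onto [Y], which fixes the points of [Y] in the chart.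
    It supplies the representatives depending on x'' alone that [JY] demands. *)
Definition retract (F : X -> C R) : X -> C R :=
  fun x => F (param c (drop_x' (coord c x))).

Lemma retract_depends W F : depends_on_x'' d c W (retract F).
Proof.
move=> x y _ _ xy; congr (F (param c _)); apply/rowP => i; rewrite !mxE.
by case: ltnP => // /xy.
Qed.

(** The projection fixes [coord c p] because [p] is in [Y]; by continuity it sends nearby points to
    points where [F \o param c] is differentiable. *)
Lemma holo_retract F : holo p F -> holo p (retract F).
Proof.
have [_ hol _] := hc; move=> /(holoP _ hol cp) dF; apply/(holoP _ hol cp).
have dropc (P : set 'rV[C R]_n) : (\forall z \near coord c p, P z) ->
    \forall z \near coord c p, P (drop_x' z).
  have : drop_x' z @[z --> coord c p] --> drop_x' (coord c p).
    exact/differentiable_continuous/differentiable_drop_x'.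
  by rewrite (drop_x'_coord cp Yp); apply.
have zK := near_join (near_paramK cp).
apply: filterS2 (dropc _ dF) zK => z dFz {}zK.
apply: near_eq_differentiable
  (differentiable_comp (differentiable_drop_x' z) dFz).
by apply: filterS zK => w; rewrite /= /retract => ->.
Qed.

Lemma germ_of_retract F : holo p F -> germ_of Yp (retract F) = germ_of Yp F.
Proof.
move=> hF; apply/germ_of_eq => //; first exact: holo_retract.
apply: filterS (near_dom cp) => x cx Yx.
by rewrite /retract drop_x'_coord ?coordK.
Qed.

End Retraction.

(** * Closure of JY under sums and products *)

Section Indicial.
Context {R : realType} {n : nat} {X : cmanifold R n}.
Variables (Y : set X) (M : dmodule X) (U : opens X) (u : sec M U).
Variables (d : nat) (c : chart R X n) (T : opens X) (theta : Dop T).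
Variables (p : X) (Yp : Y p).
Hypotheses (hc : adapted_chart Y d c) (cp : dom c p).
Hypothesis htheta : euler_field Y theta.

Let JYp := JY u d c theta (Yp := Yp).

Definition theta_poly W (WT : oset W `<=` oset T) N (F : nat -> holsec W) :
  Dop W := \sum_(k < N) mulop (F k) * resD WT theta ^+ k.

Lemma theta_poly_res V W (VW : oset V `<=` oset W) (WT : oset W `<=` oset T)
    (VT : oset V `<=` oset T) N F :
  resD VW (theta_poly WT N F) = theta_poly VT N (fun k => holsec_res VW (F k)).
Proof.
rewrite (big_morph _ (resDD VW) (resD0 VW)); apply: eq_bigr => k _.
by rewrite resDM resD_mulop resDX (resD_comp _ _ VT).
Qed.

Lemma theta_poly_widen W (WT : oset W `<=` oset T) m N (F : nat -> holsec W) :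
  (m <= N)%N -> (forall k, (m <= k)%N -> F k = holsec_cst W 0) ->
  theta_poly WT N F = theta_poly WT m F.
Proof.
move=> mN F0; rewrite /theta_poly.
rewrite (big_ord_widen _ (fun k => mulop (F k) * resD WT theta ^+ k) mN).
rewrite [RHS]big_mkcond /=; apply: eq_bigr => k _; case: ltnP => // /F0 ->.
by rewrite -[mulop _]/(0 : Dop W) mul0r.
Qed.

(* The condition of JY, but the coefficients need not be functions of x'' and
   there may be coefficients with zero germ beyond the degree of f. *)
Definition JYrel (f : {poly germ Yp}) W (F : nat -> holsec W) N :=
  [/\ oset W p, oset W `<=` dom c, (size f <= N)%N,
      forall k, germ_of Yp (F k) = f`_k &
      exists (WU : oset W `<=` oset U) (WT : oset W `<=` oset T) (Q : Dop W),
        Vfil Y (-1) Q /\ theta_poly WT N F *: res WU u = Q *: res WU u].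

Lemma JYrel_res f V W (VW : oset V `<=` oset W) F N : oset V p ->
  JYrel f F N -> JYrel f (fun k => holsec_res VW (F k)) N.
Proof.
move=> Vp [Wp Wc sf Ff [WU [WT [Q [hQ e]]]]]; split=> //.
  exact: subset_trans Wc.
exists (subset_trans VW WU), (subset_trans VW WT), (resD VW Q).
split; first exact: Vfil_res.
rewrite -(theta_poly_res VW WT) -(res_comp WU VW) -!res_scale.
by rewrite e.
Qed.

(** The two operators differ by coefficients vanishing on [Y] times powers of theta. This difference
    is in V^{-1} and is absorbed into [Q]. *)
Lemma JYrel_vanish f V (F G : nat -> holsec V) N : JYrel f F N ->
  (forall k, germ_of Yp (G k) = f`_k) ->
  (forall k x, (k < N)%N -> oset V x -> Y x -> F k x = G k x) ->
  JYrel f G N.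
Proof.
move=> [Vp Vc sf _ [VU [VT [Q [hQ e]]]]] Gf FG; split=> //.
pose D := theta_poly VT N (fun k => holsecB (G k) (F k)).
have DE : theta_poly VT N G = D + theta_poly VT N F.
  rewrite -big_split /=; apply: eq_bigr => k _.
  by rewrite mulopB mulrBl subrK.
exists VU, VT, (D + Q); split; last by rewrite DE !scalerDl e.
apply: VfilD => //; apply: Vfil_sum => k; rewrite -[-1]addr0.
apply: VfilM; last exact/VfilX/Vfil_euler_field/euler_field_res.
apply: Vfil_mulop_vanish => x Vx Yx /=.
by rewrite -[LHS]/(G k x - F k x) FG // subrr.
Qed.

(** The coefficients below [size f] are replaced by their retractions and the others by zero. Near
    [p] this changes nothing on [Y], so [JYrel_vanish] applies. *)
Lemma JYrel_JY f W (F : nat -> holsec W) N : JYrel f F N -> JYp f.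
Proof.
move=> h; have [Wp Wc sf Ff _] := h.
pose G k : X -> C R := if (k < size f)%N then retract d c (F k) else cst 0.
have hG k : holo p (G k).
  rewrite /G; case: ifP => _; last exact: holo_cst.
  exact: (holo_retract hc cp Yp (hsvalP (F k) Wp)).
have Gf k : germ_of Yp (G k) = f`_k.
  rewrite /G; case: ltnP => kf.
    by rewrite (germ_of_retract hc cp Yp (hsvalP (F k) Wp)) Ff.
  by rewrite nth_default // -(germ_of0 Yp).
(* Only finitely many coefficients occur in the operator, so one neighborhood suits all of them. *)
have nearG : \forall x \near p, forall k : 'I_N,
    holo x (G k) /\ (Y x -> F k x = G k x).
  apply: filter_forall => k; apply: filterS2 (holo_near (hG k)) _.
    by move=> x; exact: conj.
  by apply/(germ_of_eq Yp (hsvalP (F k) Wp) (hG k)); rewrite Ff Gf.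
have [V [VW Vp VG]] := opens_shrink Wp nearG.
have hGV k x : oset V x -> holo x (G k).
  move=> Vx; case: (ltnP k N) => [kN|Nk].
    by have [] := VG x Vx (Ordinal kN).
  by rewrite /G ltnNge (leq_trans sf Nk) /=; exact: holo_cst.
pose GV k : holsec V := HolSec (@hGV k).
have {}h : JYrel f GV N.
  apply: (JYrel_vanish (JYrel_res VW Vp h)) => // k x kN Vx Yx.
  by have [_] := VG x Vx (Ordinal kN); apply.
have [_ Vc _ _ [VU [VT [Q [hQ e]]]]] := h.
exists V, VU, VT; split=> //; exists GV, Q; split=> //.
  move=> k; split; last exact: Gf.
  rewrite /= /G; case: ifP => _; last by move=> x y.
  exact: retract_depends.
rewrite -e; congr (_ *: _); rewrite (theta_poly_widen _ sf) // => k fk.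
(* [theta_poly_widen] asks for equality with the zero section as a record, hence also for
   identification of the holomorphy proofs. *)
have E : GV k = cst 0 :> (X -> C R) by rewrite /= /G ltnNge fk.
move: (GV k) E => [g hg] /= E; rewrite /holsec_cst; move: hg; rewrite E => hg.
by congr HolSec; exact: Prop_irrelevance.
Qed.

Lemma JY_JYrel f : JYp f -> exists W (F : nat -> holsec W), JYrel f F (size f).
Proof.
move=> [W [WU [WT [Wp Wc [F [Q [Ff hQ e]]]]]]]; exists W, F; split=> //.
  by move=> k; have [] := Ff k.
by exists WU, WT, Q.
Qed.

(** Padding with zeros gives two relations a common length, so that they can be added
    coefficientwise. *)
Lemma JYrel_widen f W (F : nat -> holsec W) m N : JYrel f F m -> (m <= N)%N ->
  JYrel f (fun k => if (k < m)%N then F k else holsec_cst W 0) N.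
Proof.
move=> [Wp Wc sf Ff [WU [WT [Q [hQ e]]]]] mN; split=> //.
- exact: leq_trans mN.
- move=> k; case: ltnP => mk //.
  by rewrite nth_default ?(leq_trans sf) // -(germ_of0 Yp).
exists WU, WT, Q; split=> //; rewrite -e; congr (_ *: _).
rewrite (theta_poly_widen _ mN) => [|k]; last by rewrite ltnNge => ->.
by apply: eq_bigr => k _; rewrite ltn_ord.
Qed.

Lemma JYD f g : JYp f -> JYp g -> JYp (f + g).
Proof.
move=> /JY_JYrel[W1 [F1 h1]] /JY_JYrel[W2 [F2 h2]].
have s1 : oset (opensI W1 W2) `<=` oset W1 by move=> x [].
have s2 : oset (opensI W1 W2) `<=` oset W2 by move=> x [].
have Wp : oset (opensI W1 W2) p by split; [have [] := h1|have [] := h2].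
have := JYrel_widen (JYrel_res s1 Wp h1) (leq_maxl _ (size g)).
have := JYrel_widen (JYrel_res s2 Wp h2) (leq_maxr (size f) _).
set N := maxn _ _; set G2 := fun k => _; set G1 := fun k => _.
move=> [_ _ sf hG2 [WU [WT [Q2 [hQ2 e2]]]]].
move=> [_ Wc sg hG1 [WU1 [WT1 [Q1 [hQ1 e1]]]]].
rewrite (Prop_irrelevance WU1 WU) (Prop_irrelevance WT1 WT) in e1.
apply: (@JYrel_JY _ _ (fun k => holsecD (G1 k) (G2 k)) N); split=> //.
- exact: leq_trans (size_polyD _ _) _.
- move=> k; rewrite coefD -hG1 -hG2; apply: germ_ofD; exact: hsvalP.
exists WU, WT, (Q1 + Q2); split; first exact: VfilD.
rewrite scalerDl -e1 -e2 -scalerDl -big_split; congr (_ *: _).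
by apply: eq_bigr => k _; rewrite mulopD mulrDl.
Qed.

(** Multiply the relation on the left by a representative of [a], after shrinking to where it is
    holomorphic; this multiplication has order 0 in the V-filtration. *)
Lemma JYC a f : JYp f -> JYp (a%:P * f).
Proof.
move=> /JY_JYrel[W [F h]]; have [Wp _ _ _ _] := h.
have [V [VW Vp hA]] := opens_shrink Wp (holo_near (germ_rep_holo a)).
have [_ Vc sf Ff [VU [VT [Q [hQ e]]]]] := JYrel_res VW Vp h.
pose A : holsec V := HolSec hA.
apply: (@JYrel_JY _ V (fun k => holsecM A (holsec_res VW (F k))) (size f)).
split=> //.
- by rewrite mul_polyC; exact: size_scale_leq.
- move=> k; rewrite coefCM -Ff -[a in RHS]germ_repK; apply: germ_ofM.
    exact: germ_rep_holo.
  exact: hsvalP.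
exists VU, VT, (mulop A * Q); split.
  by rewrite -[-1]add0r; apply: VfilM => //; exact: Vfil_mulop.
rewrite -scalerA -e scalerA; congr (_ *: _); rewrite mulr_sumr.
by apply: eq_bigr => k _; rewrite mulopM mulrA.
Qed.

Lemma JYX f : JYp f -> JYp (f * 'X).
Proof.
move=> /JY_JYrel[W [F [Wp Wc sf Ff [WU [WT [Q [hQ e]]]]]]].
pose G k := if k is k'.+1 then F k' else holsec_cst W 0.
apply: (@JYrel_JY _ W G (size f).+1); split=> //.
- by apply: leq_trans (size_polyMleq _ _) _; rewrite size_polyX addn2.
- by case=> [|k]; rewrite coefMX //= -(germ_of0 Yp).
set th := resD WT theta in e *.
have hth : euler_field Y th by exact: euler_field_res.
(* [E] is what separates theta composed with the old operator from the operator with shifted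
   coefficients [G]; it is a sum of commutators, in V^{-1}, times powers of theta. *)
pose E := \sum_(k < size f) (th * mulop (F k) - mulop (F k) * th) * th ^+ k.
exists WU, WT, (th * Q - E); split.
  apply: VfilD.
    by rewrite -[-1]add0r; apply: VfilM => //; exact: Vfil_euler_field.
  apply/VfilN/Vfil_sum => k; rewrite -[-1]addr0; apply: VfilM.
    exact: Vfil_euler_comm hc Wc.
  exact/VfilX/Vfil_euler_field.
rewrite scalerBl -scalerA -e scalerA -scalerBl; congr (_ *: _).
rewrite /theta_poly big_ord_recl /= -[mulop (holsec_cst _ _)]/(0 : Dop W).
rewrite mul0r add0r.
rewrite mulr_sumr -sumrB; apply: eq_bigr => k _.
by rewrite -/th mulrBl opprB mulrA addrC subrK exprS mulrA.
Qed.

Lemma JYM h f : JYp f -> JYp (h * f).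
Proof.
move=> Jf; elim/poly_ind: h => [|h a IHh]; first by rewrite -polyC0; exact: JYC.
by rewrite mulrDl mulrAC; apply: JYD; [exact: JYX|exact: JYC].
Qed.

End Indicial.

Theorem proposition2 (R : realType) (n : nat) (X : cmanifold R n)
    (Y : set X) (hY : submanifold Y)
    (M : dmodule X) (hM : coherent M)
    (p : X) (Yp : Y p)
    (U : opens X) (Up : oset U p) (u : sec M U)
    (d : nat) (c : chart R X n) (hc : adapted_chart Y d c) (cp : dom c p)
    (T : opens X) (Tp : oset T p) (theta : Dop T)
    (htheta : euler_field Y theta)
    (b : {poly C R}) (hb : is_bfunction u d c theta Yp b) :
  ((exists bt : {poly germ Yp}, is_indicial u d c theta bt) /\
   (forall bt : {poly germ Yp}, is_indicial u d c theta bt ->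
      indicial_at bt %| b)) /\
  (forall bt : {poly germ Yp}, is_indicial u d c theta bt ->
     forall z : C R, root (indicial_at bt) z = root b z).
Proof.
have [mb Jb minb] := hb.
have evU (a : germ Yp) : germ_eval a != 0 -> exists a', a' * a = 1.
  exact: germ_unit.
have JD := JYD hc cp htheta (u := u) (Yp := Yp).
have JM := JYM hc cp htheta (u := u) (Yp := Yp).
split; first split.
(* The b-function with its coefficients read as constant germs is a monic element of the ideal, and
   [is_indicial] unfolds to [least_monic]. *)
- by apply: least_monic_exists Jb; rewrite monic_map.
- move=> bt lbt.
  have <- : map_poly (@germ_eval R n X p Y Yp) (map_poly (germ_cst Yp) b) = b.
    by apply/polyP => i; rewrite !coef_map /= germ_cstK.
  exact: (dvdp_least_monic evU JD JM lbt Jb).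
- move=> bt lbt z.
  exact: (root_least_monic evU JD JM (germ_cstK Yp) z lbt mb Jb minb).
Qed.
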